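(* Let $W=(\omega_1,\dots,\omega_r)$ be a suitable basis of $A$ at $\{\beta_1,\ldots,\beta_I\}$. (i) Let $e_w\in C[x]$ and $M_w\in C[x]^{r\times r}$ be such that $SW=\frac1{e_w}M_wW$ (with $\gcd$ of $e_w$ and all entries of $M_w$ equal to $1$). Then $e_w$ is shift-free and every root of $e_w$ in $\bar C$ lies in $\{\beta_1,\dots,\beta_I\}$. (ii) Let $f_w\in C[x]$ and $N_w\in C[x]^{r\times r}$ be such that $W=\frac1{f_w}N_wSW$ (with $\gcd$ of $f_w$ and all entries of $N_w$ equal to $1$). Then $f_w$ is shift-free and every root of $f_w$ in $\bar C$ lies in $\{\beta_1,\dots,\beta_I\}$. In particular $M_w$ and $N_w$ are invertible over $C(x)$.
   Context: Let $C$ be a field of characteristic zero and $\bar C$ its algebraic closure; $\sigma(f)(x)=f(x+1)$, $C(x)[S]$ the Ore algebra with $Sf=\sigma(f)S$. Fix $L=\sum_{i=0}^r\ell_iS^i\in C[x][S]$ with $\ell_0\ell_r\ne0$ and $A=C(x)[S]/C(x)[S]L$; for a basis $W$, $SW=(S\omega_1,\dots,S\omega_r)$. For $\alpha\in\bar C$, operators $P=\sum p_iS^i$ act on $b:\alpha+\mathbb Z\to\bar C((q))$ by $(P\cdot b)(z)=\sum p_i(z+q)b(z+i)$; $\operatorname{Sol}_\alpha(L)=\{b:L\cdot b=0\}$; $\operatorname{val}_\alpha(f)=\min_{b\in\operatorname{Sol}_\alpha(L)}(\nu_q((f\cdot b)(\alpha))-\liminf_n\nu_q(b(\alpha-n)))$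 ($\nu_q$ the $q$-adic valuation, $\infty-\infty=\infty$); $f$ is integral at $\alpha$ if $\operatorname{val}_\alpha(f)\ge0$; with $C(x)_\alpha=\{p/q:q(\alpha)\ne0\}$, a local integral basis at $\alpha$ is a basis of the $C(x)_\alpha$-module of integral elements at $\alpha$, and at a set $Z$ if it is one at each point of $Z$. On $\alpha+\mathbb Z$, $\beta<\gamma$ means $\beta-\gamma$ is a negative integer. A polynomial $p$ is shift-free if $\gcd(p,\sigma^i(p))=1$ for all nonzero $i\in\mathbb Z$. Suitable bases: let $\alpha_1+\mathbb Z,\dots,\alpha_I+\mathbb Z$ be the distinct orbits in $\bar C/\mathbb Z$ containing a root of $\ell_0\ell_r$; in orbit $i$ let $\alpha_{i,1}<\dots<\alpha_{i,J_i}$ be the roots of $\ell_0\ell_r$, and choose $\beta_i\in\alpha_i+\mathbb Z$ with $\alpha_{i,J_i}\le\beta_i$, such that whenever $\alpha_{i,J_i}$ and $\alpha_{i',J_{i'}}$ are conjugate over $C$ one has $\beta_i-\alpha_{i,J_i}=\beta_{i'}-\alpha_{i',J_{i'}}$. Let $Z=\bigcup_{i=1}^I\{\gamma\in\alpha_i+\mathbb Z\mid\alpha_{i,1}<\gamma\le\beta_i\}$. A $C(x)$-basis $W$ of $A$ is suitable at $\{\beta_1,\dots,\beta_I\}$ if it is a local integral basis of $A$ at $Z$ and, for every $\alpha\in\bar C\setminus Z$, it generates the same $C(x)_\alpha$-module as $\{1,S,\dots,S^{r-1}\}$. *)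

(* Defs.v *)
From HB Require Import structures.
From mathcomp Require Import all_boot all_order all_algebra.
From mathcomp Require Import boolp classical_sets constructive_ereal ereal sequences.
From Stdlib Require Rdefinitions.
From mathcomp Require Import Rstruct.
Notation R := Rdefinitions.R.

Set Implicit Arguments.
Unset Strict Implicit.
Unset Printing Implicit Defensive.

Import Order.TTheory GRing.Theory Num.Theory.
Local Open Scope ring_scope.

(* A record (k, f) denotes  sum_{n>=0} f n * q^(k+n).                    *)
Record laurent (L : Type) := Laurent { lstart : int; lcoef : nat -> L }.

Definition lco (L : fieldType) (s : laurent L) (j : int) : L :=
  if (lstart s <= j)%R then lcoef s `|j - lstart s|%N else 0.

Definition lzero (L : fieldType) : laurent L := Laurent 0 (fun _ => 0).

Definition ladd (L : fieldType) (s t : laurent L) : laurent L :=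
  let m := if (lstart s <= lstart t)%R then lstart s else lstart t in
  Laurent m (fun n => lco s (m + n%:Z) + lco t (m + n%:Z)).

Definition lmul (L : fieldType) (s t : laurent L) : laurent L :=
  Laurent (lstart s + lstart t)
    (fun n => \sum_(i < n.+1) lcoef s i * lcoef t (n - i)%N).

Definition lsum (L : fieldType) (ss : seq (laurent L)) : laurent L :=
  foldr (@ladd L) (lzero L) ss.

Definition lpoly (L : fieldType) (p : {poly L}) : laurent L :=
  Laurent 0 (fun n => p`_n).

(* first coefficients of the inverse of a power series u with u 0 != 0 *)
Fixpoint psinv_seq (L : fieldType) (u : nat -> L) (n : nat) : seq L :=
  match n with
  | 0 => [:: (u 0%N)^-1]
  | n'.+1 => let cs := psinv_seq u n' in
             rcons cs (- (u 0%N)^-1 * \sum_(i < n'.+1) u i.+1 * cs`_(n' - i))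
  end.

Definition psinv (L : fieldType) (u : nat -> L) (n : nat) : L :=
  (psinv_seq u n)`_n.

Definition linv (L : fieldType) (s : laurent L) : laurent L :=
  match pselect (exists n, lcoef s n != 0) with
  | left H =>
      let m := ex_minn H in
      Laurent (- (lstart s + m%:Z)) (psinv (fun n => lcoef s (n + m)%N))
  | right _ => lzero L
  end.

(* q-adic valuation, in the extended reals (+oo for the zero series) *)
Definition qval (L : fieldType) (s : laurent L) : \bar R :=
  ereal_inf [set ((j%:~R : R)%:E) | j in [set j : int | lco s j != 0]].

Notation ratf C := {fraction {poly C}}.
Notation "x %:F" := (@FracField.tofrac _ x).

Definition num (C : fieldType) (f : ratf C) : {poly C} := \n_(repr f).
Definition den (C : fieldType) (f : ratf C) : {poly C} := \d_(repr f).

Definition sigmaP (C : fieldType) (p : {poly C}) : {poly C} := p \Po ('X + 1).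
Definition sigmaF (C : fieldType) (f : ratf C) : ratf C :=
  (sigmaP (num f))%:F / (sigmaP (den f))%:F.

Definition pat (C L : fieldType) (io : {rmorphism C -> L}) (p : {poly C}) (z : L)
  : laurent L := lpoly ((map_poly io p) \Po ('X + z%:P)).

Definition fat (C L : fieldType) (io : {rmorphism C -> L}) (f : ratf C) (z : L)
  : laurent L := lmul (pat io (num f) z) (linv (pat io (den f) z)).

Definition loc_ring (C L : fieldType) (io : {rmorphism C -> L}) (alpha : L)
  (f : ratf C) : Prop :=
  exists p q : {poly C}, (map_poly io q).[alpha] != 0 /\ f = p%:F / q%:F.

(* The module A = C(x)[S] / C(x)[S] L.  The operator                    *)
(* L = sum_{i<=r} ell`_i S^i is given by ell : {poly {poly C}} of       *)
(* size r.+1.  Elements of A are coordinate rows w.r.t. the basis       *)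
(* 1, S, ..., S^(r-1); a basis W is an r x r matrix whose rows are the  *)
(* coordinates of omega_1, ..., omega_r.                                *)
Definition vcoef (F : Type) (zero : F) (r : nat) (a : 'rV[F]_r) (k : nat) : F :=
  if insub k is Some i then a 0 i else zero.

(* S * a in A (using S f = sigma(f) S and S^r = - sum_{j<r} (ell_j/ell_r) S^j) *)
Definition shiftA (C : fieldType) (r : nat) (ell : {poly {poly C}})
  (a : 'rV[ratf C]_r) : 'rV[ratf C]_r :=
  \row_(j < r)
    ((if (j : nat) == 0%N then 0 else sigmaF (vcoef 0 a j.-1))
     - sigmaF (vcoef 0 a r.-1) * (ell`_j)%:F / (ell`_r)%:F).

Definition shiftW (C : fieldType) (r : nat) (ell : {poly {poly C}})
  (W : 'M[ratf C]_r) : 'M[ratf C]_r :=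
  \matrix_(i < r, j < r) shiftA ell (row i W) 0 j.

(* b : int -> laurent L encodes b(alpha + k) = b k.                      *)
Definition actL (C L : fieldType) (io : {rmorphism C -> L}) (r : nat)
  (ell : {poly {poly C}}) (alpha : L) (b : int -> laurent L) (k : int) : laurent L :=
  lsum [seq lmul (pat io ell`_i (alpha + k%:~R)) (b (k + i%:Z)) | i <- iota 0 r.+1].

Definition actA (C L : fieldType) (io : {rmorphism C -> L}) (r : nat)
  (a : 'rV[ratf C]_r) (alpha : L) (b : int -> laurent L) (k : int) : laurent L :=
  lsum [seq lmul (fat io (a 0 i) (alpha + k%:~R)) (b (k + (i : nat)%:Z))
       | i <- enum 'I_r].

Definition is_sol (C L : fieldType) (io : {rmorphism C -> L}) (r : nat)
  (ell : {poly {poly C}}) (alpha : L) (b : int -> laurent L) : Prop :=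
  forall k j, lco (actL io r ell alpha b k) j = 0.

Definition xdiff (x y : \bar R) : \bar R :=
  if (x == +oo%E) && (y == +oo%E) then +oo%E else (x - y)%E.

Definition val_term (C L : fieldType) (io : {rmorphism C -> L}) (r : nat)
  (alpha : L) (a : 'rV[ratf C]_r) (b : int -> laurent L) : \bar R :=
  xdiff (qval (actA io a alpha b 0))
        (limn_einf (fun n : nat => qval (b (- n%:Z)))).

(* val_alpha(a) = min over solutions (taken as an infimum) *)
Definition val_at (C L : fieldType) (io : {rmorphism C -> L}) (r : nat)
  (ell : {poly {poly C}}) (alpha : L) (a : 'rV[ratf C]_r) : \bar R :=
  ereal_inf [set val_term io alpha a b | b in [set b | is_sol io r ell alpha b]].

Definition integral_at (C L : fieldType) (io : {rmorphism C -> L}) (r : nat)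
  (ell : {poly {poly C}}) (alpha : L) (a : 'rV[ratf C]_r) : Prop :=
  (0 <= val_at io ell alpha a)%E.

Definition local_integral_basis (C L : fieldType) (io : {rmorphism C -> L})
  (r : nat) (ell : {poly {poly C}}) (alpha : L) (W : 'M[ratf C]_r) : Prop :=
  W \in unitmx /\
  forall a : 'rV[ratf C]_r,
    integral_at io ell alpha a <->
    exists c : 'rV[ratf C]_r, (forall i, loc_ring io alpha (c 0 i)) /\ a = c *m W.

Definition is_intL (L : fieldType) (z : L) : Prop := exists k : int, z = k%:~R.

Definition sing_root (C L : fieldType) (io : {rmorphism C -> L}) (r : nat)
  (ell : {poly {poly C}}) (z : L) : Prop :=
  root (map_poly io (ell`_0 * ell`_r)) z.

(* conjugate over C : same vanishing polynomials over C (same minimal polynomial) *)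
Definition conjugate_over (C L : fieldType) (io : {rmorphism C -> L}) (u v : L) : Prop :=
  forall p : {poly C}, root (map_poly io p) u = root (map_poly io p) v.

Definition max_root_in (C L : fieldType) (io : {rmorphism C -> L}) (r : nat)
  (ell : {poly {poly C}}) (beta rho : L) : Prop :=
  sing_root io r ell rho /\ is_intL (rho - beta) /\
  forall rho', sing_root io r ell rho' -> is_intL (rho' - beta) ->
    exists n : nat, rho = rho' + n%:R.

Definition admissible_betas (C L : fieldType) (io : {rmorphism C -> L}) (r : nat)
  (ell : {poly {poly C}}) (I : nat) (beta : 'I_I -> L) : Prop :=
  (forall i j, i != j -> ~ is_intL (beta i - beta j)) /\
  (forall i, exists rho, sing_root io r ell rho /\ is_intL (rho - beta i)) /\
  (forall rho, sing_root io r ell rho -> exists i, is_intL (rho - beta i)) /\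
  (forall i rho, sing_root io r ell rho -> is_intL (rho - beta i) ->
     exists n : nat, beta i = rho + n%:R) /\
  (forall i i' rho rho', max_root_in io r ell (beta i) rho ->
     max_root_in io r ell (beta i') rho' -> conjugate_over io rho rho' ->
     beta i - rho = beta i' - rho').

(* gamma in Z : gamma in beta_i + Z with alpha_{i,1} < gamma <= beta_i *)
Definition inZ (C L : fieldType) (io : {rmorphism C -> L}) (r : nat)
  (ell : {poly {poly C}}) (I : nat) (beta : 'I_I -> L) (gamma : L) : Prop :=
  exists i : 'I_I,
    (exists n : nat, beta i = gamma + n%:R) /\
    (exists rho, sing_root io r ell rho /\ is_intL (rho - beta i) /\
       (forall rho', sing_root io r ell rho' -> is_intL (rho' - beta i) ->
          exists n : nat, rho' = rho + n%:R) /\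
       exists m : nat, gamma = rho + m.+1%:R).

Definition suitable (C L : fieldType) (io : {rmorphism C -> L}) (r : nat)
  (ell : {poly {poly C}}) (I : nat) (beta : 'I_I -> L) (W : 'M[ratf C]_r) : Prop :=
  W \in unitmx /\
  (forall gamma, inZ io r ell beta gamma -> local_integral_basis io ell gamma W) /\
  (forall alpha, ~ inZ io r ell beta alpha ->
     forall a : 'rV[ratf C]_r,
       (exists c : 'rV[ratf C]_r, (forall i, loc_ring io alpha (c 0 i)) /\ a = c *m W)
       <-> (forall i, loc_ring io alpha (a 0 i))).

Definition shift_free (C : fieldType) (p : {poly C}) : Prop :=
  forall i : int, i != 0 -> coprimep p (p \Po ('X + (i%:~R)%:P)).

Definition gcd_one (C : fieldType) (r : nat) (e : {poly C}) (M : 'M[{poly C}]_r) : Prop :=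
  gcdp e (\big[@gcdp C/0]_(ij : 'I_r * 'I_r) M ij.1 ij.2) %= 1.

(* Main.v *)
Require Import Defs.
From HB Require Import structures.
From mathcomp Require Import all_boot all_order all_algebra.
From mathcomp Require Import boolp classical_sets constructive_ereal ereal sequences.
From mathcomp Require Import Rstruct zify.
Import Order.TTheory GRing.Theory Num.Theory.
Local Open Scope ring_scope.
Local Open Scope quotient_scope.
Set Implicit Arguments.
Unset Strict Implicit.

(** Write Lam_z for the lattice spanned by W over the local ring at z. A root z
    of e_w (resp. f_w) is a point where S Lam_{z+1} is not contained in Lam_z
    (resp. does not contain it), so it suffices to show S Lam_{z+1} = Lam_z
    for z outside the betas. Since (S a . b)(z) = (a . b)(z+1) for every
    solution b, S maps the elements integral at z+1 onto those integral at z;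
    this settles the case where both z and z+1 lie in Z. If only z+1 does, then
    z is the leftmost singularity of its orbit; to its left the recurrence runs
    in both directions over power series, so integrality at z means having
    coordinates in the local ring, i.e. lying in Lam_z. If neither lies in Z,
    then z is not a singularity and both lattices are spanned by the powers of
    S, which S and its inverse preserve. Shift-freeness follows because distinct
    betas lie in distinct orbits. *)

(** [num] and [den] come from an arbitrary representative picked by [repr]; this lets that choice be
    handled as an honest quotient. *)
Lemma frac_numden (R : idomainType) (x : {fraction R}) :
  x = (\n_(repr x))%:F / (\d_(repr x))%:F.
Proof.
have d0 : \d_(repr x) != 0 by exact: denom_ratioP.
apply: (canRL (mulfK _)); first by rewrite tofrac_eq0.
rewrite -{1}[x]reprK; unlock FracField.tofrac.
rewrite -[LHS]FracField.pi_mul; apply/eqmodP.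
rewrite /= FracField.equivfE /FracField.mulf !numden_Ratio ?oner_eq0 ?mulr1 //.
by rewrite mulrC.
Qed.

(** * Power series *)

Record ps (L : fieldType) := PS { psc : nat -> L }.

HB.instance Definition _ (L : fieldType) := gen_eqMixin (ps L).
HB.instance Definition _ (L : fieldType) := gen_choiceMixin (ps L).

Section PowerSeries.
Variable L : fieldType.
Implicit Types f g h : ps L.

Lemma psP f g : (forall n, psc f n = psc g n) -> f = g.
Proof. by case: f g => [f] [g] /= /funext ->. Qed.

Definition ps_add f g : ps L := PS (fun n => psc f n + psc g n).
Definition ps_opp f : ps L := PS (fun n => - psc f n).
Definition ps_zero : ps L := PS (fun _ => 0).
Definition ps_one : ps L := PS (fun n => (n == 0%N)%:R).
Definition ps_mul f g : ps L :=
  PS (fun n => \sum_(i < n.+1) psc f i * psc g (n - i)%N).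

Fact ps_addA : associative ps_add.
Proof. by move=> f g h; apply: psP => n /=; rewrite addrA. Qed.
Fact ps_addC : commutative ps_add.
Proof. by move=> f g; apply: psP => n /=; rewrite addrC. Qed.
Fact ps_add0 : left_id ps_zero ps_add.
Proof. by move=> f; apply: psP => n /=; rewrite add0r. Qed.
Fact ps_addN : left_inverse ps_zero ps_opp ps_add.
Proof. by move=> f; apply: psP => n /=; rewrite addNr. Qed.

HB.instance Definition _ :=
  GRing.isZmodule.Build (ps L) ps_addA ps_addC ps_add0 ps_addN.

Definition ps_trunc n f : {poly L} := \poly_(i < n.+1) psc f i.

Lemma ps_trunc_coef n f k : (k <= n)%N -> (ps_trunc n f)`_k = psc f k.
Proof. by move=> kn; rewrite coef_poly ltnS kn. Qed.

(* The n-th coefficient of a product only sees truncations, so the ring laws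
   are inherited from those of polynomials. *)
Lemma ps_mul_trunc n f g k : (k <= n)%N ->
  psc (ps_mul f g) k = (ps_trunc n f * ps_trunc n g)`_k.
Proof.
move=> kn; rewrite coefM; apply: eq_bigr => i _.
have ik : (i <= k)%N by rewrite -ltnS.
by rewrite !ps_trunc_coef // (leq_trans _ kn) // leq_subr.
Qed.

Fact ps_mulC : commutative ps_mul.
Proof.
by move=> f g; apply: psP => n; rewrite !(@ps_mul_trunc n) // mulrC.
Qed.

Fact ps_mulA : associative ps_mul.
Proof.
move=> f g h; apply: psP => n.
(* Coefficient [n] sees the right factor only up to degree [n], so the truncation of a product may
   be replaced by the product of truncations. *)
have mull (p q : {poly L}) (q' : ps L) : (forall k, (k <= n)%N -> psc q' k = q`_k) ->
    (p * ps_trunc n q')`_n = (p * q)`_n.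
  move=> e; rewrite !coefM; apply: eq_bigr => i _.
  by rewrite ps_trunc_coef ?leq_subr // e ?leq_subr.
rewrite (@ps_mul_trunc n) // (mull _ (ps_trunc n g * ps_trunc n h)); last first.
  by move=> k; exact: ps_mul_trunc.
rewrite ps_mulC (@ps_mul_trunc n) // (mull _ (ps_trunc n f * ps_trunc n g)).
  by rewrite mulrA mulrC.
by move=> k; exact: ps_mul_trunc.
Qed.

Fact ps_mul1 : left_id ps_one ps_mul.
Proof.
move=> f; apply: psP => n /=; rewrite big_ord_recl /= mul1r subn0 big1 ?addr0 //.
by move=> i _; rewrite mul0r.
Qed.

Fact ps_mulDl : left_distributive ps_mul ps_add.
Proof.
move=> f g h; apply: psP => n /=; rewrite -big_split /=.
by apply: eq_bigr => i _; rewrite mulrDl.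
Qed.

Fact ps_1neq0 : ps_one != 0.
Proof.
by apply/eqP => /(congr1 (fun f => psc f 0%N)) /= /eqP; rewrite oner_eq0.
Qed.

HB.instance Definition _ :=
  GRing.Zmodule_isComNzRing.Build (ps L) ps_mulA ps_mulC ps_mul1 ps_mulDl ps_1neq0.

Lemma pscM f g n : psc (f * g) n = \sum_(i < n.+1) psc f i * psc g (n - i)%N.
Proof. by []. Qed.

Lemma size_psinv_seq (u : nat -> L) n : size (psinv_seq u n) = n.+1.
Proof. by elim: n => [|n IH] //=; rewrite size_rcons IH. Qed.

Lemma psinv_seqE (u : nat -> L) n k : (k <= n)%N -> (psinv_seq u n)`_k = psinv u k.
Proof.
elim: n => [|n IH]; first by rewrite leqn0 => /eqP ->.
rewrite leq_eqVlt => /orP[/eqP -> //|kn] /=.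
by rewrite nth_rcons size_psinv_seq kn IH.
Qed.

Lemma psinvS (u : nat -> L) n :
  psinv u n.+1 = - (u 0%N)^-1 * \sum_(i < n.+1) u i.+1 * psinv u (n - i)%N.
Proof.
rewrite /psinv [in LHS]/= nth_rcons size_psinv_seq ltnn eqxx.
by congr (_ * _); apply: eq_bigr => i _; rewrite (psinv_seqE u (leq_subr i n)).
Qed.

Lemma ps_mul_psinv f : psc f 0%N != 0 -> f * PS (psinv (psc f)) = 1.
Proof.
move=> f0; apply: psP => -[|n]; rewrite pscM /=.
  by rewrite big_ord_recl big_ord0 addr0 divff.
rewrite big_ord_recl /= subn0 psinvS mulrA mulrN divff // mulN1r.
by rewrite addrC; apply/eqP; rewrite subr_eq0; apply/eqP; apply: eq_bigr.
Qed.

Definition ps_unit : pred (ps L) := fun f => psc f 0%N != 0.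
Definition ps_inv f : ps L :=
  if psc f 0%N != 0 then PS (psinv (psc f)) else f.

Fact ps_mulVr : {in ps_unit, left_inverse 1 ps_inv *%R}.
Proof.
by move=> f f0; rewrite mulrC /ps_inv; rewrite unfold_in in f0; rewrite f0 ps_mul_psinv.
Qed.
Fact ps_unitP f g : g * f = 1 -> ps_unit f.
Proof.
move=> /(congr1 (fun f => psc f 0%N)); rewrite pscM /= big_ord_recl big_ord0 addr0.
by move=> e; apply/eqP => f0; move/eqP: e; rewrite f0 mulr0 eq_sym oner_eq0.
Qed.
Fact ps_inv_out : {in [predC ps_unit], ps_inv =1 id}.
Proof. by move=> f; rewrite inE /= unfold_in /ps_inv => /negbTE ->. Qed.

HB.instance Definition _ :=
  GRing.ComNzRing_hasMulInverse.Build (ps L) ps_mulVr ps_unitP ps_inv_out.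

Lemma ps_neq0 f : f != 0 -> exists n, psc f n != 0.
Proof.
move=> f0; apply: contrapT => nE; case/eqP: f0; apply: psP => n /=.
by apply/eqP; apply: contra_notT nE => fn; exists n.
Qed.

Definition psX : ps L := PS (fun n => (n == 1%N)%:R).

Lemma psXnE k n : psc (psX ^+ k) n = (n == k)%:R.
Proof.
elim: k n => [|k IH] [|n]; first by rewrite expr0.
- by rewrite expr0.
- by rewrite exprS pscM big_ord_recl big_ord0 /= mul0r addr0.
rewrite exprS pscM big_ord_recl /= mul0r add0r big_ord_recl /= mul1r big1.
  by rewrite addr0 subn1 /= IH eqSS.
by move=> i _; rewrite mul0r.
Qed.

Lemma psXnM k f n : psc (psX ^+ k * f) n = if (n < k)%N then 0 else psc f (n - k)%N.
Proof.
rewrite pscM; case: ltnP => kn.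
  apply: big1 => i _; rewrite psXnE; case: eqP => [e|]; last by rewrite mul0r.
  by have := ltn_ord i; rewrite e ltnS leqNgt kn.
have kn' : (k < n.+1)%N by [].
rewrite (bigD1 (Ordinal kn')) //= psXnE eqxx mul1r big1 ?addr0 // => i ik.
by rewrite psXnE; case: eqP => [e|]; [case/eqP: ik; apply: val_inj | rewrite mul0r].
Qed.

Lemma psX_neq0 : psX != 0.
Proof.
by apply/eqP => /(congr1 (fun f => psc f 1%N)) /= /eqP; rewrite oner_eq0.
Qed.

(** The exponent is the index of the lowest nonzero coefficient; the cofactor is then a unit. *)
Lemma ps_factor f : f != 0 ->
  exists k g, f = psX ^+ k * g /\ psc g 0%N != 0.
Proof.
move=> /ps_neq0 ex; case: (ex_minnP ex) => m fm mmin.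
exists m, (PS (fun n => psc f (n + m)%N)); split=> //.
apply: psP => n; rewrite psXnM; case: ltnP => nm; last by rewrite /= subnK.
by apply/eqP; apply: contraTT nm => fn; rewrite -leqNgt mmin.
Qed.

Fact ps_idomain : GRing.integral_domain_axiom (ps L).
Proof.
move=> f g fg; apply: contraT; rewrite negb_or => /andP[].
move=> /ps_factor[k [f' [ef f'0]]] /ps_factor[m [g' [eg g'0]]].
(* Coefficient [k + m] of the product is the product of the two lowest nonzero coefficients. *)
move/(congr1 (fun h => psc h (k + m)%N)): fg.
rewrite ef eg mulrACA -exprD psXnM ltnn subnn pscM big_ord_recl big_ord0 addr0 /=.
by move/eqP; rewrite mulf_eq0 (negbTE f'0) (negbTE g'0).
Qed.

HB.instance Definition _ := GRing.ComUnitRing_isIntegral.Build (ps L) ps_idomain.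

Definition ps_poly (p : {poly L}) : ps L := PS (fun n => p`_n).

Fact ps_poly_zmod : zmod_morphism ps_poly.
Proof. by move=> p q; apply: psP => n /=; rewrite coefB. Qed.
Fact ps_poly_monoid : monoid_morphism ps_poly.
Proof.
split=> [|p q]; apply: psP => n /=; first by rewrite coef1.
by rewrite coefM.
Qed.
HB.instance Definition _ := GRing.isZmodMorphism.Build {poly L} (ps L) ps_poly ps_poly_zmod.
HB.instance Definition _ := GRing.isMonoidMorphism.Build {poly L} (ps L) ps_poly ps_poly_monoid.

Lemma ps_poly_inj : injective ps_poly.
Proof.
by move=> p q e; apply/polyP => n; have := congr1 (fun f => psc f n) e.
Qed.

End PowerSeries.

(** * Laurent series *)

Section LaurentField.
Variable L : fieldType.
Local Notation K := {fraction (ps L)}.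
Implicit Types (s t : laurent L) (x y : K) (n m : int).

(** The field $L((q))$ is realised as the fraction field [K] of the power series, so that
    computations with records become field algebra; [lq] is $q$. *)
Definition lq : K := (psX L)%:F.

Lemma lq_neq0 : lq != 0.
Proof. by rewrite tofrac_eq0 psX_neq0. Qed.

(* The series denoted by the record s, as an element of the field L((q)). *)
Definition lval s : K := lq ^ (lstart s) * (PS (lcoef s))%:F.

Lemma lq_natE (k : nat) : lq ^ k = (psX L ^+ k)%:F.
Proof. by rewrite -exprnP tofracXn. Qed.

(** Padding with leading zeros lowers the starting index, so several records can be written over a
    common one. *)
Lemma lval_shift s m : m <= lstart s ->
  lval s = lq ^ m * (PS (fun n : nat => lco s (m + n%:Z)))%:F.
Proof.
move=> ms; have [k ek] : exists k : nat, lstart s = m + k by exists (`|lstart s - m|)%N; lia.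
rewrite /lval ek expfzDr ?lq_neq0 // -mulrA lq_natE -tofracM; congr (_ * _%:F).
apply: psP => n; rewrite psXnM /= /lco ek; case: ltnP => nk.
  by case: ifP => //; lia.
by case: ifP; last lia; move=> _; congr (lcoef s _); lia.
Qed.

Lemma lval_eq0 s : lval s = 0 <-> forall j, lco s j = 0.
Proof.
split=> [/eqP|s0].
  rewrite /lval mulf_eq0 expfz_eq0 (negbTE lq_neq0) andbF /= tofrac_eq0 => /eqP e j.
  rewrite /lco; case: ifP => // _.
  exact: (congr1 (fun f => psc f `|j - lstart s|%N) e).
rewrite (lval_shift (lexx _)); set f := PS _.
suff -> : f = 0 by rewrite rmorph0 mulr0.
by apply: psP => n /=; rewrite s0.
Qed.

(* The q-adic valuation of x is at least n. *)
Definition lge n x := exists u : ps L, x = lq ^ n * u%:F.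

Lemma lgeD n x y : lge n x -> lge n y -> lge n (x + y).
Proof. by move=> [u ->] [v ->]; exists (u + v); rewrite tofracD mulrDr. Qed.

Lemma lge0 n : lge n 0.
Proof. by exists 0; rewrite tofrac0 mulr0. Qed.

Lemma lgeM x n y : lge 0 x -> lge n y -> lge n (x * y).
Proof.
by move=> [u ->] [v ->]; exists (u * v); rewrite expr0z mul1r mulrCA tofracM.
Qed.

Lemma lge_tofrac (u : ps L) : lge 0 u%:F.
Proof. by exists u; rewrite mul1r. Qed.

Lemma lgeN n x : lge n x -> lge n (- x).
Proof. by move=> [u ->]; exists (- u); rewrite tofracN mulrN. Qed.

Lemma lge_sum n (J : Type) (r : seq J) (P : pred J) (F : J -> K) :
  (forall i, P i -> lge n (F i)) -> lge n (\sum_(i <- r | P i) F i).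
Proof. by move=> h; elim/big_rec: _ => [|i x Pi]; [exact: lge0 | exact/lgeD/h]. Qed.

Lemma lge_inv (u : ps L) : psc u 0%N != 0 -> lge 0 (u%:F)^-1.
Proof.
move=> u0; have uu : u \is a GRing.unit by [].
rewrite (_ : _^-1 = (u^-1)%:F); first exact: lge_tofrac.
by apply: mulr1_eq; rewrite -tofracM divrr // tofrac1.
Qed.

Lemma lge_lval n s : lge n (lval s) <-> forall j, j < n -> lco s j = 0.
Proof.
(* An index below both the start of [s] and [n], from which both sides expand as power series. *)
pose m := Num.min (lstart s) n.
have ms : m <= lstart s by rewrite /m; lia.
have [k ek] : exists k : nat, n = m + k by exists (`|n - m|)%N; rewrite /m; lia.
rewrite (lval_shift ms); split=> [[u]|s0].
  rewrite ek expfzDr ?lq_neq0 // -mulrA => /(mulfI (expfz_neq0 _ lq_neq0)).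
  rewrite lq_natE -tofracM => /eqP; rewrite tofrac_eq => /eqP e j jn.
  have [mj|jm] := leP m j; last by rewrite /lco; case: ifP => //; lia.
  have := congr1 (fun f => psc f `|j - m|%N) e; rewrite psXnM /=.
  by case: ltnP => h; [move=> <-; congr lco; lia | lia].
exists (PS (fun i : nat => lco s (n + i%:Z))).
rewrite ek expfzDr ?lq_neq0 // -mulrA lq_natE -tofracM; congr (_ * _%:F).
apply: psP => i; rewrite psXnM /=; case: ltnP => h; first by apply: s0; lia.
by congr lco; lia.
Qed.

Lemma lvalM s t : lval (lmul s t) = lval s * lval t.
Proof. by rewrite /lval /= expfzDr ?lq_neq0 // mulrACA -tofracM. Qed.

Lemma lvalD s t : lval (ladd s t) = lval s + lval t.
Proof.
rewrite {1}/lval /=; set m := (if _ then _ else _).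
have ms : m <= lstart s by rewrite /m; case: ifP; lia.
have mt : m <= lstart t by rewrite /m; case: ifP; lia.
by rewrite (lval_shift ms) (lval_shift mt) -mulrDr -tofracD.
Qed.

Lemma lval_lzero : lval (lzero L) = 0.
Proof. by apply/lval_eq0 => j; rewrite /lco /=; case: ifP. Qed.

Lemma lval_lsum ss : lval (lsum ss) = \sum_(s <- ss) lval s.
Proof.
by elim: ss => [|s ss IH] /=; rewrite ?big_nil ?lval_lzero // big_cons lvalD IH.
Qed.

Lemma lvalV s : lval (linv s) = (lval s)^-1.
Proof.
rewrite /linv; case: pselect => [ex|nex]; last first.
  (* For the zero series [linv] returns zero, in agreement with the convention [0^-1 = 0] in a
     field. *)
  rewrite lval_lzero (_ : lval s = 0) ?invr0 //; apply/lval_eq0 => j.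
  rewrite /lco; case: ifP => // _; apply/eqP.
  by apply: contra_notT nex => h; eexists; exact: h.
case: ex_minnP => m sm mmin; pose u (i : nat) := lcoef s (i + m)%N.
have u0 : psc (PS u) 0%N != 0 by [].
rewrite {2}/lval; have -> : PS (lcoef s) = psX L ^+ m * PS u.
  apply: psP => i; rewrite psXnM /= /u; case: ltnP => im; last by rewrite subnK.
  by apply/eqP; apply: contraTT im => h; rewrite -leqNgt mmin.
rewrite tofracM mulrA -lq_natE -expfzDr ?lq_neq0 // invfM invr_expz.
rewrite /lval /=; congr (_ * _).
apply/esym/(@mulr1_eq (FracField.type (ps L))).
by rewrite -tofracM ps_mul_psinv // tofrac1.
Qed.

(** Lets a solution with values in [K] be turned back into one with values in records. *)
Lemma lval_surj x : exists s, lval s = x.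
Proof.
have h (u : ps L) : lval (Laurent 0 (psc u)) = u%:F by rewrite /lval expr0z mul1r; case: u.
exists (lmul (Laurent 0 (psc \n_(repr x))) (linv (Laurent 0 (psc \d_(repr x))))).
by rewrite lvalM lvalV !h -frac_numden.
Qed.

End LaurentField.

(** * Lower limits and valuations in the extended reals *)

Lemma limn_einf_gt (u : nat -> \bar R) (x : \bar R) : (x < limn_einf u)%E ->
  exists N, forall n, (N <= n)%N -> (x < u n)%E.
Proof.
rewrite limn_einf_lim (cvg_lim _ (@cvg_einfs_sup _ u)) // => /ereal_sup_gt[_ [N _ <-]] xN.
exists N => n Nn; apply: (lt_le_trans xN); apply: ereal_inf_lbound.
by exists n.
Qed.

(** The lower limit is the supremum of the infima over tails, and the tail from [N] already reaches
    [x]. *)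
Lemma limn_einf_ge (u : nat -> \bar R) (x : \bar R) N :
  (forall n, (N <= n)%N -> (x <= u n)%E) -> (x <= limn_einf u)%E.
Proof.
move=> h; rewrite limn_einf_lim (cvg_lim _ (@cvg_einfs_sup _ u)) //.
apply: le_ereal_sup_tmp; exists (einfs u N); first by exists N.
by apply: le_ereal_inf_tmp => _ [n /= Nn <-]; exact: h.
Qed.

(** The convention $\infty-\infty=\infty$ is what makes the case [x = y = +oo] agree. The hypothesis
    excludes [x = y = -oo], and holds for every [qval]. *)
Lemma xdiff_ge0 (x y : \bar R) : x != -oo%E -> (0 <= xdiff x y)%E = (y <= x)%E.
Proof.
rewrite /xdiff; case: x => [x| |] //; case: y => [y| |] //= _;
  by rewrite ?leey ?leNye // !lee_fin subr_ge0.
Qed.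

Section Qval.
Variable L : fieldType.
Implicit Types (s : laurent L) (n : int).

Lemma qval_ge n s : ((n%:~R : R)%:E <= qval s)%E <-> lge n (lval s).
Proof.
rewrite lge_lval; split=> [/ereal_infP h j jn|h].
  apply/eqP; apply: contraTT jn => sj; rewrite -leNgt -(ler_int R) -lee_fin.
  by apply: h; exists j.
apply/ereal_infP => _ [j /= sj <-]; rewrite lee_fin ler_int leNgt.
by apply/negP => /h sj0; rewrite sj0 eqxx in sj.
Qed.

Lemma qval_neqNy s : qval s != -oo%E.
Proof.
apply/negP => /eqP s0.
have : ((((lstart s)%:~R : R)%:E <= qval s)%E) by apply/qval_ge; exists (PS (lcoef s)).
by rewrite s0.
Qed.

End Qval.

(** * Extending morphisms to fractions *)

Section FracLift.
Variables (R : idomainType) (F : fieldType) (h : {rmorphism R -> F}).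
Hypothesis h_inj : injective h.

(** Written through [repr] so that [sigmaF] is an instance by mere unfolding. *)
Definition frac_lift (f : {fraction R}) : F := h \n_(repr f) / h \d_(repr f).

(** Two representatives agree after cross-multiplication, which [h] preserves; injectivity keeps the
    denominators nonzero. *)
Lemma frac_liftE p q : q != 0 -> frac_lift (p%:F / q%:F) = h p / h q.
Proof.
move=> q0; rewrite /frac_lift; set f := p%:F / q%:F.
have d0 : \d_(repr f) != 0 by exact: denom_ratioP.
have hn0 x : x != 0 -> h x != 0 by rewrite -(rmorph0 h) (inj_eq h_inj).
have : f = (\n_(repr f))%:F / (\d_(repr f))%:F by exact: frac_numden.
move/eqP; rewrite {1}/f eqr_div ?tofrac_eq0 // -!tofracM tofrac_eq => /eqP e.
by apply/eqP; rewrite eqr_div ?hn0 // -!rmorphM -e.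
Qed.

Lemma frac_lift_tofrac p : frac_lift p%:F = h p.
Proof.
by rewrite -[p%:F]divr1 -tofrac1 frac_liftE ?oner_eq0 // rmorph1 divr1.
Qed.

Lemma frac_ind (P : {fraction R} -> Prop) :
  (forall p q, q != 0 -> P (p%:F / q%:F)) -> forall f, P f.
Proof. by move=> hP f; rewrite [f]frac_numden; apply/hP/denom_ratioP. Qed.

Lemma frac_lift_zmod : zmod_morphism frac_lift.
Proof.
have hn0 x : x != 0 -> h x != 0 by rewrite -(rmorph0 h) (inj_eq h_inj).
elim/frac_ind=> p q q0; elim/frac_ind=> p' q' q0'.
rewrite -mulNr -tofracN addf_div ?tofrac_eq0 // -!tofracM -tofracD.
rewrite !frac_liftE ?mulf_neq0 // -mulNr addf_div ?hn0 //.
by rewrite !(rmorphD, rmorphM, rmorphN).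
Qed.

Lemma frac_lift_monoid : monoid_morphism frac_lift.
Proof.
split; first by rewrite -tofrac1 frac_lift_tofrac rmorph1.
elim/frac_ind=> p q q0; elim/frac_ind=> p' q' q0'.
by rewrite mulf_div -!tofracM !frac_liftE ?mulf_neq0 // !rmorphM mulf_div.
Qed.

End FracLift.

(** * The shift automorphism of polynomials and rational functions *)

Section Shift.
Variable C : fieldType.

Lemma comp_polyXD_inj (F : fieldType) (z : F) :
  injective (comp_poly ('X + z%:P) : {poly F} -> {poly F}).
Proof.
apply: (can_inj (g := comp_poly ('X - z%:P))) => p.
by rewrite -comp_polyA comp_polyD comp_polyC comp_polyX subrK comp_polyXr.
Qed.

Definition sigmaH (p : {poly C}) : ratf C := (sigmaP p)%:F.

Fact sigmaH_zmod : zmod_morphism sigmaH.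
Proof. by move=> p q; rewrite /sigmaH /sigmaP !rmorphB. Qed.
Fact sigmaH_monoid : monoid_morphism sigmaH.
Proof. by split=> [|p q]; rewrite /sigmaH /sigmaP (rmorph1, rmorphM) ?rmorphM ?rmorph1. Qed.
HB.instance Definition _ := GRing.isZmodMorphism.Build {poly C} (ratf C) sigmaH sigmaH_zmod.
HB.instance Definition _ := GRing.isMonoidMorphism.Build {poly C} (ratf C) sigmaH sigmaH_monoid.

Lemma sigmaH_inj : injective sigmaH.
Proof.
move=> p q /eqP; rewrite /sigmaH tofrac_eq => /eqP.
by rewrite /sigmaP -(polyC1 C); exact: comp_polyXD_inj.
Qed.

Fact sigmaF_zmod : zmod_morphism (@sigmaF C).
Proof. exact: (frac_lift_zmod sigmaH_inj). Qed.
Fact sigmaF_monoid : monoid_morphism (@sigmaF C).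
Proof. exact: (frac_lift_monoid sigmaH_inj). Qed.
HB.instance Definition _ := GRing.isZmodMorphism.Build (ratf C) (ratf C) (@sigmaF C) sigmaF_zmod.
HB.instance Definition _ := GRing.isMonoidMorphism.Build (ratf C) (ratf C)
  (@sigmaF C) sigmaF_monoid.

Lemma sigmaFE p q : q != 0 -> sigmaF (p%:F / q%:F) = (sigmaP p)%:F / (sigmaP q)%:F :> ratf C.
Proof. exact: (frac_liftE sigmaH_inj). Qed.

Lemma sigmaF_surj (f : ratf C) : exists g, sigmaF g = f.
Proof.
elim/frac_ind: f => p q q0; pose t (p : {poly C}) := p \Po ('X - 1%:P).
have tK p' : sigmaP (t p') = p'.
  by rewrite /sigmaP /t -comp_polyA comp_polyB comp_polyC comp_polyX polyC1 addrK comp_polyXr.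
exists ((t p)%:F / (t q)%:F); rewrite sigmaFE ?tK //.
by apply: contraNneq q0 => tq; rewrite -[q]tK tq /sigmaP comp_poly0.
Qed.

End Shift.

(** * Expansion of rational functions at a point *)

Section Expansion.
Variables (C L : fieldType) (io : {rmorphism C -> L}).
Local Notation K := {fraction (ps L)}.
Implicit Types (z : L) (p q : {poly C}) (f : ratf C).

(** The Taylor expansion of [p] at [z], in $q=x-z$. *)
Definition pexp z p : K := (ps_poly (map_poly io p \Po ('X + z%:P)))%:F.

Fact pexp_zmod z : zmod_morphism (pexp z).
Proof. by move=> p q; rewrite /pexp !rmorphB. Qed.
Fact pexp_monoid z : monoid_morphism (pexp z).
Proof. by split=> [|p q]; rewrite /pexp ?rmorph1 // !rmorphM. Qed.
HB.instance Definition _ z := GRing.isZmodMorphism.Build {poly C} K (pexp z) (pexp_zmod z).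
HB.instance Definition _ z := GRing.isMonoidMorphism.Build {poly C} K (pexp z) (pexp_monoid z).

Lemma pexp_inj z : injective (pexp z).
Proof.
move=> p q /eqP; rewrite /pexp tofrac_eq => /eqP /ps_poly_inj /comp_polyXD_inj.
exact: map_poly_inj.
Qed.

Lemma pexp_eq0 z p : (pexp z p == 0) = (p == 0).
Proof. by rewrite -[0 in LHS](rmorph0 (pexp z)) (inj_eq (@pexp_inj z)). Qed.

Lemma pexp_coef0 z p :
  psc (ps_poly (map_poly io p \Po ('X + z%:P))) 0%N = (map_poly io p).[z].
Proof. by rewrite /= -horner_coef0 horner_comp !hornerE. Qed.

Lemma lval_pat z p : lval (pat io p z) = pexp z p.
Proof. by rewrite /lval /= expr0z mul1r. Qed.

Definition fexp z : ratf C -> K := frac_lift (pexp z).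

Fact fexp_zmod z : zmod_morphism (fexp z).
Proof. exact: (frac_lift_zmod (@pexp_inj z)). Qed.
Fact fexp_monoid z : monoid_morphism (fexp z).
Proof. exact: (frac_lift_monoid (@pexp_inj z)). Qed.
HB.instance Definition _ z := GRing.isZmodMorphism.Build (ratf C) K (fexp z) (fexp_zmod z).
HB.instance Definition _ z := GRing.isMonoidMorphism.Build (ratf C) K (fexp z) (fexp_monoid z).

Lemma fexpE z p q : q != 0 -> fexp z (p%:F / q%:F) = pexp z p / pexp z q.
Proof. exact: (frac_liftE (@pexp_inj z)). Qed.

Lemma fexp_tofrac z p : fexp z p%:F = pexp z p.
Proof. exact: (frac_lift_tofrac (@pexp_inj z)). Qed.

Lemma lval_fat z f : lval (fat io f z) = fexp z f.
Proof. by rewrite /fat lvalM lvalV !lval_pat. Qed.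

Lemma pexp_sigma z p : pexp z (sigmaP p) = pexp (z + 1) p.
Proof.
rewrite /pexp /sigmaP map_comp_poly -comp_polyA -(polyC1 C) map_polyXaddC rmorph1.
by rewrite comp_polyD comp_polyX comp_polyC -addrA -polyCD.
Qed.

Lemma fexp_sigma z f : fexp z (sigmaF f) = fexp (z + 1) f.
Proof.
elim/frac_ind: f => p q q0; rewrite sigmaFE // !fexpE ?pexp_sigma //.
by rewrite -(pexp_eq0 z) pexp_sigma pexp_eq0.
Qed.

Lemma pexp_lge z p : lge 0 (pexp z p).
Proof. exact: lge_tofrac. Qed.

Lemma pexpV_lge z p : (map_poly io p).[z] != 0 -> lge 0 (pexp z p)^-1.
Proof. by move=> pz; apply: lge_inv; rewrite pexp_coef0. Qed.

(** Regularity at [z] means that the expansion there has no polar part. For the converse the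
    fraction is put in lowest terms: a zero of its denominator at [z] would force one of its
    numerator. *)
Lemma loc_ringP z f : loc_ring io z f <-> lge 0 (fexp z f).
Proof.
split=> [[p [q [qz ->]]]|].
  have q0 : q != 0 by apply: contraNneq qz => ->; rewrite rmorph0 horner0.
  by rewrite fexpE //; apply: lgeM; [exact: pexp_lge | exact: pexpV_lge].
elim/frac_ind: f => p q q0; pose d := gcdp p q.
have d0 : d != 0 by rewrite gcdp_eq0 negb_and q0 orbT.
have [ep eq'] : p = (p %/ d) * d /\ q = (q %/ d) * d.
  by rewrite !divpK ?dvdp_gcdl ?dvdp_gcdr.
move: (p %/ d) (q %/ d) ep eq' (@coprimep_div_gcd _ p q) => p' q' ep eq'.
rewrite q0 orbT => /(_ isT); rewrite ep eq'; rewrite eq' in q0.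
have q'0 : q' != 0 by apply: contraNneq q0 => ->; rewrite mul0r.
rewrite !tofracM -mulf_div divff ?tofrac_eq0 // mulr1 fexpE // => cop [u].
have q'z0 : pexp z q' != 0 by rewrite pexp_eq0.
rewrite expr0z mul1r => /(canRL (divfK q'z0)).
rewrite /pexp -tofracM => /eqP; rewrite tofrac_eq => /eqP /(congr1 (fun v => psc v 0%N)).
rewrite pscM big_ord_recl big_ord0 addr0 subnn !pexp_coef0 => e.
exists p', q'; split=> //; apply/eqP => q'z.
move: e; rewrite q'z mulr0 => p'z.
have cop' : coprimep (map_poly io p') (map_poly io q') by rewrite coprimep_map.
by have := coprimep_root cop' (introT rootP p'z); rewrite q'z eqxx.
Qed.

End Expansion.

(** * Linear recurrences *)

Section Recurrence.
Variables (K : fieldType) (r : nat).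

(** Equation [k] can be solved for the value at [k + r], since its top coefficient is nonzero. *)
Lemma recurrence_forward (c : nat -> nat -> K) (u : nat -> K) :
  (forall k, c k r != 0) ->
  exists f : nat -> K, (forall j, (j < r)%N -> f j = u j) /\
    forall k, \sum_(i < r.+1) c k i * f (k + i)%N = 0.
Proof.
move=> c0.
pose next n (s : seq K) := - (c n r)^-1 * \sum_(i < r) c n i * s`_(n + i)%N.
(* [F n] lists the first [r + n] values; by [FD] the later lists extend it, so [f] is well read off
   from any long enough list. *)
pose F n := iteri n (fun n s => rcons s (next n s)) (mkseq u r).
have szF n : size (F n) = (r + n)%N.
  elim: n => [|n IH]; first by rewrite size_mkseq addn0.
  by rewrite size_rcons -/(F n) IH addnS.
have FD n m k : (k < r + n)%N -> (F (n + m)%N)`_k = (F n)`_k.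
  move=> kn; elim: m => [|m IH]; first by rewrite addn0.
  rewrite addnS -IH [F (n + m).+1]/(rcons (F (n + m)%N) _) nth_rcons szF.
  by rewrite (leq_trans kn) ?leq_add2l ?leq_addr.
pose f k := (F k.+1)`_k.
have fE n k : (k < r + n)%N -> (F n)`_k = f k.
  move=> kn; rewrite /f -(FD n k.+1 k) // addnC FD //; lia.
exists f; split=> [j jr|k].
  by rewrite -(fE 0%N) ?addn0 // /F /= nth_mkseq.
rewrite big_ord_recr /= -(fE k.+1 (k + r)%N); last by lia.
rewrite [F k.+1]/(rcons (F k) _) nth_rcons szF [(k + r)%N]addnC ltnn eqxx /next.
rewrite mulrA mulrN divff // mulN1r.
apply/eqP; rewrite subr_eq0; apply/eqP; apply: eq_bigr => i _.
by rewrite fE //; have := ltn_ord i; lia.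
Qed.

Lemma recurrence_twosided (c : int -> nat -> K) (u : nat -> K) :
  (forall k, c k 0%N != 0) -> (forall k, c k r != 0) ->
  exists b : int -> K, (forall j : nat, (j < r)%N -> b j = u j) /\
    forall k, \sum_(i < r.+1) c k i * b (k + i%:Z) = 0.
Proof.
move=> c0 cr.
have [f [fu fr]] := @recurrence_forward (fun k => c k) u (fun k => cr k).
(* The equations at negative indices are read from right to left: coefficients and initial values
   are reversed, so that [g j] is the value at [r - 1 - j]. *)
have [|g [gu gr]] := @recurrence_forward (fun k i => c (Negz k) (r - i)%N)
  (fun j => u (r.-1 - j)%N); first by move=> k; rewrite subnn.
exists (fun k => match k with Posz n => f n | Negz m => g (r + m)%N end).
split=> [j|[k|k]]; [exact: fu | exact: fr |].
rewrite -[RHS](gr k) (reindex_inj rev_ord_inj) /=; apply: eq_bigr => i _.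
rewrite subSS; congr (_ * _); have := ltn_ord i; rewrite ltnS => ir.
(* The position is either negative, where [g] is used, or one of the [r] initial ones, where [f] and
   [g] both follow [u]. *)
case: (leqP (r - i) k) => h.
  have -> : Negz k + (r - i)%N = Negz (k - (r - i)) by lia.
  by congr g; lia.
have -> : Negz k + (r - i)%N = Posz (r - i - k.+1)%N by lia.
by rewrite fu ?gu; [congr u; lia | lia | lia].
Qed.

End Recurrence.

(** * Integrality *)

Section Integrality.
Variables (C L : fieldType) (io : {rmorphism C -> L}).
Local Notation K := {fraction (ps L)}.
Local Notation pexp := (pexp io).
Local Notation fexp := (fexp io).

Definition series_sol r (ell : {poly {poly C}}) (z : L) (b : int -> K) :=
  forall k : int, \sum_(i < r.+1) pexp (z + k%:~R) ell`_i * b (k + (i : nat)%:Z) = 0.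

Lemma lval_actL r (ell : {poly {poly C}}) z b k :
  lval (actL io r ell z b k) =
  \sum_(i < r.+1) pexp (z + k%:~R) ell`_i * lval (b (k + (i : nat)%:Z)).
Proof.
rewrite /actL lval_lsum big_map -[iota 0 r.+1]/(index_iota 0 r.+1) big_mkord.
by apply: eq_bigr => i _; rewrite lvalM lval_pat.
Qed.

Lemma lval_actA r (a : 'rV[ratf C]_r) z b k :
  lval (actA io a z b k) =
  \sum_(i < r) fexp (z + k%:~R) (a 0 i) * lval (b (k + (i : nat)%:Z)).
Proof.
rewrite /actA lval_lsum big_map big_enum /=.
by apply: eq_bigr => i _; rewrite lvalM lval_fat.
Qed.

(** Removes the infimum and the lower limit: a valuation is at least the lower limit exactly when it
    is at least every integer [m] that bounds the solution from below far to the left. *)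
Lemma integral_atP r (ell : {poly {poly C}}) z (a : 'rV[ratf C]_r) :
  integral_at io ell z a <->
  forall b, series_sol r ell z b -> forall (m : int) N,
    (forall n : nat, (N <= n)%N -> lge m (b (- n%:Z))) ->
    lge m (\sum_(i < r) fexp z (a 0 i) * b (i : nat)).
Proof.
have solE b : is_sol io r ell z b <-> series_sol r ell z (fun k => lval (b k)).
  split=> h k; first by rewrite -lval_actL; apply/lval_eq0/h.
  by apply: (proj1 (lval_eq0 _)); rewrite lval_actL; exact: h.
have actE b : lval (actA io a z b 0) = \sum_(i < r) fexp z (a 0 i) * lval (b (i : nat)).
  rewrite lval_actA; apply: eq_bigr => i _; by rewrite addr0 add0r.
split=> [/ereal_infP ia b sb m N bm|ia].
  have [s sE] := choice (fun k => lval_surj (b k)).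
  have eb : b = (fun k => lval (s k)) by apply/funext => k; rewrite sE.
  have ss : is_sol io r ell z s by apply/solE; rewrite -eb.
  have := ia _ (ex_intro2 _ _ s ss erefl).
  rewrite xdiff_ge0 ?qval_neqNy // => h; rewrite eb -actE; apply/qval_ge.
  apply: le_trans h; apply: (@limn_einf_ge _ _ N) => n Nn.
  by apply/qval_ge; rewrite sE; exact: bm.
apply/ereal_infP => _ [b /= sb <-]; rewrite xdiff_ge0 ?qval_neqNy // leNgt.
(* Otherwise some exponent [j] with nonzero coefficient in the action lies below the lower limit.
   Far to the left the solution then has valuation at least [j + 1], hence so does the action. *)
apply/negP => /ereal_inf_lt[_ [j /= bj <-]] /limn_einf_gt[N bN].
have /lge_lval/(_ j) : lge (j + 1) (lval (actA io a z b 0)).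
  rewrite actE; apply: (ia (fun k => lval (b k)) _ _ N); first exact/solE.
  move=> n /bN h; apply/lge_lval => i ij.
  apply/eqP; apply: contraTT h => bi; rewrite -leNgt.
  apply: ge_ereal_inf; exists (i%:~R%:E); first by exists i.
  by rewrite lee_fin ler_int; lia.
by move=> /(_ _)/eqP; rewrite (negbTE bj) => h; have := h ltac:(lia).
Qed.

Lemma vcoefE (F : Type) (x : F) r (a : 'rV[F]_r) (i : 'I_r) : vcoef x a i = a 0 i.
Proof. by rewrite /vcoef valK. Qed.

Lemma fexp_shiftA r (ell : {poly {poly C}}) z (a : 'rV[ratf C]_r) (i : 'I_r) :
  fexp z (shiftA ell a 0 i) =
  (if (i : nat) == 0%N then 0 else fexp (z + 1) (vcoef 0 a i.-1))
  - fexp (z + 1) (vcoef 0 a r.-1) * pexp z ell`_i / pexp z ell`_r.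
Proof.
rewrite mxE rmorphB 2!rmorphM fmorphV /= !fexp_tofrac fexp_sigma.
by case: ifP => _; rewrite ?rmorph0 // fexp_sigma.
Qed.

(** Reducing $S^r$ subtracts a multiple of $L$, which acts as zero by the equation for [b] at [z].
    Hence $(Sa\cdot b)(z)=(a\cdot b)(z+1)$. *)
Lemma shiftA_act r (ell : {poly {poly C}}) z (a : 'rV[ratf C]_r) (b : int -> K) :
  ell`_r != 0 -> \sum_(i < r.+1) pexp z ell`_i * b (i : nat) = 0 ->
  \sum_(i < r) fexp z (shiftA ell a 0 i) * b (i : nat) =
  \sum_(i < r) fexp (z + 1) (a 0 i) * b ((i : nat).+1).
Proof.
case: r a => [|r] a ellr; first by rewrite !big_ord0.
have er0 : pexp z ell`_r.+1 != 0 by rewrite pexp_eq0.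
pose A k := fexp (z + 1) (vcoef 0 a k).
move=> s0; rewrite (eq_bigr (fun i : 'I_r.+1 =>
    (if (i : nat) == 0%N then 0 else A i.-1) * b (i : nat)
    - A r / pexp z ell`_r.+1 * (pexp z ell`_i * b (i : nat)))); last first.
  move=> i _; rewrite fexp_shiftA mulrBl -/(A r) -/(A i.-1); congr (_ - _).
  by move: (A r) => x; rewrite -!mulrA [pexp z ell`_i * (_ * _)]mulrCA.
move: s0; rewrite big_ord_recr sumrB -mulr_sumr /= => /eqP; rewrite addr_eq0 => /eqP ->.
rewrite mulrN opprK -[A r / _ * _]mulrA mulKf // big_ord_recl /= mul0r add0r [RHS]big_ord_recr /=.
congr (_ + _); last by rewrite -[a 0 ord_max](vcoefE 0).
by apply: eq_bigr => i _; rewrite /A -(vcoefE 0).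
Qed.

(** Translation by one step matches the solutions based at [z] with those based at [z + 1], and
    leaves their behaviour far to the left unchanged. *)
Lemma integral_at_shift r (ell : {poly {poly C}}) z (a : 'rV[ratf C]_r) :
  ell`_r != 0 ->
  integral_at io ell (z + 1) a <-> integral_at io ell z (shiftA ell a).
Proof.
move=> ellr; rewrite !integral_atP; split=> ia b sb m N bm.
  rewrite shiftA_act //; last first.
    by rewrite -[RHS](sb 0); apply: eq_bigr => i _; rewrite addr0 add0r.
  (* The threshold grows by one: the translate at [-n] is [b] at [-(n - 1)]. *)
  have := ia (fun k => b (k + 1)) _ m N.+1.
  rewrite (eq_bigr (fun i : 'I_r => fexp (z + 1) (a 0 i) * b (i.+1 : nat))); last first.
    by move=> i _; congr (_ * b _); lia.
  apply=> [k|n Nn].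
    rewrite -[RHS](sb (k + 1)); apply: eq_bigr => i _; congr (pexp _ _ * b _); last lia.
    by rewrite rmorphD /= addrAC addrA.
  have -> : - n%:Z + 1 = - (n.-1)%:Z by lia.
  by apply: bm; lia.
pose b' k := b (k - 1); have sb' : series_sol r ell z b'.
  move=> k; rewrite -[RHS](sb (k - 1)); apply: eq_bigr => i _.
  congr (pexp _ _ * b _); last lia.
  by rewrite rmorphB /= addrA addrAC addrK.
have := ia _ sb' m N; rewrite shiftA_act //; last first.
  by rewrite -[RHS](sb' 0); apply: eq_bigr => i _; rewrite addr0 add0r.
rewrite (eq_bigr (fun i : 'I_r => fexp (z + 1) (a 0 i) * b (i : nat))); last first.
  by move=> i _; rewrite /b'; congr (_ * b _); lia.
apply=> n Nn; rewrite /b'; have -> : - n%:Z - 1 = - (n.+1)%:Z by lia.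
by apply: bm; lia.
Qed.

(* Left of every singularity the recurrence can be run in both directions over
   power series, so the liminf of a solution is the valuation of any window. *)
Lemma integral_at_left r (ell : {poly {poly C}}) (z : L) (a : 'rV[ratf C]_r) :
  ell`_0 != 0 -> ell`_r != 0 ->
  (forall n : nat, (map_poly io (ell`_0 * ell`_r)).[z - n.+1%:R] != 0) ->
  integral_at io ell z a <-> forall i, loc_ring io z (a 0 i).
Proof.
move=> ell0 ellr reg.
have reg0 n : lge 0 (pexp (z + (Negz n)%:~R) ell`_0)^-1.
  apply: pexpV_lge; have := reg n; rewrite rmorphM hornerM mulf_eq0 negb_or.
  by rewrite NegzE mulrNz => /andP[].
have regr n : lge 0 (pexp (z + (Negz n)%:~R) ell`_r)^-1.
  apply: pexpV_lge; have := reg n; rewrite rmorphM hornerM mulf_eq0 negb_or.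
  by rewrite NegzE mulrNz => /andP[].
rewrite integral_atP; split=> [ia i|std b sb m N bm].
  (* A solution equal to 1 at offset [i] and to 0 at the other offsets below [r] isolates the
     coordinate [a 0 i]. *)
  have [||b [bu sb]] := @recurrence_twosided _ r (fun k i => pexp (z + k%:~R) ell`_i)
    (fun j => (j == i :> nat)%:R); try by move=> k; rewrite pexp_eq0.
  apply/loc_ringP; have := ia b sb 0 0%N.
  rewrite (bigD1 i) //= bu // eqxx mulr1 big1 ?addr0; last first.
    by move=> j ji; rewrite bu // (negbTE (_ : (j : nat) != i)) ?mulr0.
  apply=> n _.
  (* Induction to the left: [b k] is found from its right neighbours on dividing by $\ell_0$, a unit
     at negative offsets. *)
  suff h (t : nat) (k : int) : (k < r%:Z) -> - k <= t%:Z -> lge 0 (b k).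
    by have ir := ltn_ord i; apply: (h n); lia.
  elim: t k => [|t IH] k kr kt.
    case: k kr kt => // k kr _; rewrite bu //.
    by case: eqP => _; [rewrite -tofrac1; exact: lge_tofrac | exact: lge0].
  have [|tk] := leP (- k) t; first exact: IH.
  have {tk kt} ek : k = Negz t by lia.
  have := sb k; rewrite big_ord_recl /= addr0 => /eqP; rewrite addr_eq0 => /eqP e.
  have e0 : pexp (z + k%:~R) ell`_0 != 0 by rewrite pexp_eq0.
  rewrite -[b k](mulKf e0) e; apply: lgeM; first by rewrite ek.
  apply/lgeN/lge_sum => j _; apply: lgeM; first exact: pexp_lge.
  by have jr := ltn_ord j; apply: IH; rewrite /= /bump /=; lia.
apply: lge_sum => i _; apply: lgeM; first exact/loc_ringP.
(* Induction to the right: [b k] is found by dividing by $\ell_r$ in the equation at [k - r], which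
   is still left of [z] for every [k] below [r]. *)
suff h (t : nat) (k : int) : k <= - N%:Z + t%:Z -> k < r%:Z -> lge m (b k).
  by have ir := ltn_ord i; apply: (h (N + r)%N); lia.
elim: t k => [|t IH] k kt kr.
  have -> : k = - (`|k|%N)%:Z by lia.
  by apply: bm; lia.
have [|tk] := leP k (- N%:Z + t%:Z); first by move=> h; exact: IH.
have [n en] : exists n, k - r%:Z = Negz n by exists `|(k - r%:Z + 1)%R|%N; lia.
have := sb (k - r%:Z); rewrite big_ord_recr /= subrK addrC => /eqP.
rewrite addr_eq0 => /eqP e.
have er : pexp (z + (k - r%:Z)%:~R) ell`_r != 0 by rewrite pexp_eq0.
rewrite -[b k](mulKf er) e; apply: lgeM; first by rewrite en.
apply/lgeN/lge_sum => j _; apply: lgeM; first exact: pexp_lge.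
by have jr := ltn_ord j; apply: IH; lia.
Qed.

End Integrality.

(** * Lattices and the shift *)

Section Lattices.
Variables (C L : fieldType) (io : {rmorphism C -> L}) (r : nat).
Variable ell : {poly {poly C}}.
Hypotheses (ell0 : ell`_0 != 0) (ellr : ell`_r != 0).
Implicit Types (a : 'rV[ratf C]_r) (W : 'M[ratf C]_r) (z : L).

(** Where $\ell_0$ and $\ell_r$ are both units, $S$ and its inverse introduce no denominators in
    coordinates for the powers of $S$. *)
Lemma shiftA_std z a : (map_poly io (ell`_0 * ell`_r)).[z] != 0 ->
  (forall i, loc_ring io (z + 1) (a 0 i)) <->
  (forall i, loc_ring io z (shiftA ell a 0 i)).
Proof.
rewrite rmorphM hornerM mulf_eq0 negb_or => /andP[e0z erz].
pose A k := fexp io (z + 1) (vcoef 0 a k).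
have er0 : pexp io z ell`_r != 0 by rewrite pexp_eq0.
have e00 : pexp io z ell`_0 != 0 by rewrite pexp_eq0.
pose g i := A r.-1 * pexp io z ell`_i / pexp io z ell`_r.
have gE i : lge 0 (A r.-1) -> lge 0 (g i).
  move=> h; apply: lgeM; last exact: pexpV_lge.
  by apply: lgeM => //; exact: pexp_lge.
split=> h i; apply/loc_ringP.
  have hA k : lge 0 (A k).
    rewrite /A /vcoef; case: insubP => [j _ _|_]; last by rewrite rmorph0; exact: lge0.
    exact/loc_ringP.
  rewrite fexp_shiftA; apply: lgeD; last exact/lgeN/gE.
  by case: ifP => _; [exact: lge0 | exact: hA].
have hs (j : nat) : (j < r)%N -> lge 0 ((if j == 0%N then 0 else A j.-1) - g j).
  by move=> jr; have /loc_ringP := h (Ordinal jr); rewrite fexp_shiftA.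
(* Coordinate 0 of $Sa$ is the last coordinate of [a] times $-\ell_0/\ell_r$; it is recovered first,
   and the other coordinates follow from it. *)
have Ar : lge 0 (A r.-1).
  have r0 : (0 < r)%N by have := ltn_ord i; lia.
  have := hs 0%N r0; rewrite /= sub0r => /lgeN; rewrite opprK /g => h0.
  have -> : A r.-1 = A r.-1 * pexp io z ell`_0 / pexp io z ell`_r
      * (pexp io z ell`_r * (pexp io z ell`_0)^-1).
    by move: (A _) => x; rewrite mulrA divfK // mulfK.
  by apply: lgeM => //; apply: lgeM; [exact: pexp_lge | exact: pexpV_lge].
rewrite -(vcoefE 0) -/(A i); have [ir|ri] := ltnP i.+1 r; last first.
  suff -> : (i : nat) = r.-1 by [].
  by have := ltn_ord i; lia.
by have := lgeD (hs _ ir) (gE i.+1 Ar); rewrite /= subrK.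
Qed.

(** $S$ is semilinear with respect to $\sigma$, because $Sf=\sigma(f)S$. *)
Lemma shiftA_mul (c : 'rV[ratf C]_r) W :
  shiftA ell (c *m W) = map_mx (@sigmaF C) c *m shiftW ell W.
Proof.
have vE k : sigmaF (vcoef 0 (c *m W) k) =
    \sum_i sigmaF (c 0 i) * sigmaF (vcoef 0 (row i W) k).
  rewrite /vcoef; case: insubP => [j _ _|_].
    by rewrite mxE rmorph_sum; apply: eq_bigr => i _; rewrite rmorphM mxE.
  by rewrite rmorph0 big1 // => i _; rewrite mulr0.
apply/rowP => j; rewrite [LHS]mxE [RHS]mxE.
under [RHS]eq_bigr => i _ do rewrite mxE [shiftW _ _ _ _]mxE [shiftA _ _ _ _]mxE mulrBr.
rewrite sumrB !vE; congr (_ - _).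
  by case: ifP => _ //; rewrite big1 // => i _; rewrite mulr0.
by rewrite -mulrA mulr_suml; apply: eq_bigr => i _; rewrite !mulrA.
Qed.

Lemma shiftA_surj (v : 'rV[ratf C]_r) : exists a, shiftA ell a = v.
Proof.
(* Coordinate 0 of [v] forces the last coordinate of the preimage to have image [t] under $\sigma$;
   [g] gives the images of all coordinates. *)
pose t := - vcoef 0 v 0%N * (ell`_r)%:F / (ell`_0)%:F : ratf C.
pose g k := if k == r.-1 then t else vcoef 0 v k.+1 + t * (ell`_k.+1)%:F / (ell`_r)%:F.
have [s sE] := choice (fun k => sigmaF_surj (g k)).
exists (\row_i s i); apply/rowP => j; rewrite mxE.
have vE k : (k < r)%N -> sigmaF (vcoef 0 (\row_(i < r) s i) k) = g k.
  by move=> kr; rewrite -[k]/(val (Ordinal kr)) vcoefE mxE sE.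
have jr := ltn_ord j.
rewrite !vE; try lia.
rewrite {2}/g eqxx -(vcoefE 0); case: ifP => [/eqP ->|/eqP j0].
  rewrite sub0r /t -!mulrA !mulNr opprK mulKf ?tofrac_eq0 //.
  by rewrite divff ?mulr1 ?tofrac_eq0.
rewrite /g ifF; last by lia.
by rewrite prednK ?addrK //; lia.
Qed.

(** Preimages under $S$ of the standard unit rows, expanded in [W] and twisted by $\sigma$, form a
    left inverse. *)
Lemma shiftW_unit W : W \in unitmx -> shiftW ell W \in unitmx.
Proof.
move=> uW; have [s sE] := choice (fun i : 'I_r => shiftA_surj (delta_mx 0 i)).
pose X := \matrix_i map_mx (@sigmaF C) (s i *m invmx W).
suff /mulmx1_unit[] : X *m shiftW ell W = 1%:M by [].
apply/row_matrixP => i; rewrite row_mul rowK -shiftA_mul mulmxKV // sE.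
by rewrite rowE mulmx1.
Qed.

Definition in_lattice z W a :=
  exists c : 'rV[ratf C]_r, (forall i, loc_ring io z (c 0 i)) /\ a = c *m W.

Lemma in_lattice_row z W i : in_lattice z W (row i W).
Proof.
exists (delta_mx 0 i); split; last by rewrite rowE.
move=> j; exists ((0 == 0 :> 'I_1) && (j == i))%:R, 1.
by rewrite rmorph1 hornerC oner_eq0 mxE tofrac1 divr1 rmorph_nat.
Qed.

Lemma loc_ring_sigma z f : loc_ring io (z + 1) f -> loc_ring io z (sigmaF f).
Proof. by move=> /loc_ringP h; apply/loc_ringP; rewrite fexp_sigma. Qed.

Lemma loc_ring_root z (p q : {poly C}) : q != 0 -> root (map_poly io q) z ->
  loc_ring io z (q%:F^-1 * p%:F) -> root (map_poly io p) z.
Proof.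
move=> q0 /rootP qz [p' [q' [q'z /eqP]]].
have q'0 : q' != 0 by apply: contraNneq q'z => ->; rewrite rmorph0 horner0.
rewrite mulrC eqr_div ?tofrac_eq0 // -!tofracM tofrac_eq => /eqP.
move/(congr1 (fun s => (map_poly io s).[z])); rewrite !rmorphM !hornerM qz mulr0.
by move/eqP; rewrite mulf_eq0 (negbTE q'z) orbF.
Qed.

(** Polynomial gcds are compatible with the extension to [L], so a common root would be a root of a
    nonzero constant. *)
Lemma gcd_one_root (e : {poly C}) (M : 'M[{poly C}]_r) z : gcd_one e M ->
  root (map_poly io e) z -> ~ (forall i j, root (map_poly io (M i j)) z).
Proof.
rewrite /gcd_one -(eqp_map io) rmorph1 => /eqp_root/(_ z) + ez Mz.
rewrite rootC oner_eq0 gcdp_map root_gcd ez /=.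
suff -> : root (map_poly io (\big[@gcdp C/0]_(ij : 'I_r * 'I_r) M ij.1 ij.2)) z by [].
elim/big_rec: _ => [|ij p _ pz]; first by rewrite rmorph0 root0.
by rewrite gcdp_map root_gcd Mz pz.
Qed.

(** Row [i] of $M/e$ holds the coordinates of $S\omega_i$ in [W]. They are regular at [z], so the
    zero of the denominator must cancel. *)
Lemma shift_lattice_loc z W (e : {poly C}) (M : 'M[{poly C}]_r) : e != 0 ->
  W \in unitmx -> (forall a, in_lattice (z + 1) W a -> in_lattice z W (shiftA ell a)) ->
  shiftW ell W = (e%:F)^-1 *: (map_mx (fun p => p%:F) M *m W) ->
  root (map_poly io e) z -> forall i j, root (map_poly io (M i j)) z.
Proof.
move=> e0 uW lat eW ez i j; have [c [lc]] := lat _ (in_lattice_row (z + 1) W i).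
have -> : shiftA ell (row i W) = row i (shiftW ell W) by apply/rowP => k; rewrite !mxE.
rewrite eW scalemxAl row_mul => /(can_inj (mulmxK uW)) /rowP/(_ j).
rewrite !mxE => ec; apply: (loc_ring_root e0 ez); rewrite ec; exact: lc.
Qed.

(** Here $\omega_i=Sa$ with [a] in the lattice at [z + 1]. Row [i] of $N/f$ is then $\sigma$ applied
    to the coordinates of [a], hence regular at [z]. *)
Lemma unshift_lattice_loc z W (f : {poly C}) (N : 'M[{poly C}]_r) : f != 0 ->
  W \in unitmx -> (forall a, in_lattice z W (shiftA ell a) -> in_lattice (z + 1) W a) ->
  W = (f%:F)^-1 *: (map_mx (fun p => p%:F) N *m shiftW ell W) ->
  root (map_poly io f) z -> forall i j, root (map_poly io (N i j)) z.
Proof.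
move=> f0 uW lat eW fz i j; have [a sa] := shiftA_surj (row i W).
have [|c [lc ac]] := lat a; first by rewrite sa; exact: in_lattice_row.
move: sa; rewrite ac shiftA_mul {2}eW scalemxAl row_mul.
move=> /(can_inj (mulmxK (shiftW_unit uW))) /rowP/(_ j).
rewrite !mxE => ec; apply: (loc_ring_root f0 fz); rewrite -ec; exact/loc_ring_sigma/lc.
Qed.

End Lattices.

(** * Position of the singularities *)

Section Singularities.
Variables (C : fieldType) (L : closedFieldType) (io : {rmorphism C -> L}).
Hypothesis charC0 : [pchar C] =i pred0.
Variables (r : nat) (ell : {poly {poly C}}) (I : nat) (beta : 'I_I -> L).
Hypotheses (ell0 : ell`_0 != 0) (ellr : ell`_r != 0).
Hypothesis Hbeta : admissible_betas io r ell beta.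
Local Notation sing := (sing_root io r ell).
Implicit Types (z rho : L).

Lemma pchar0_natr_eq0 n : (n%:R == 0 :> L) = (n == 0%N).
Proof. by rewrite -(rmorph_nat io) fmorph_eq0; move/pcharf0P: charC0 => ->. Qed.

Lemma pchar0_natr_inj n m : n%:R = m%:R :> L -> n = m.
Proof.
wlog nm : n m / (n <= m)%N => [h e|].
  by case: (leqP n m) => [|/ltnW] /h; [exact | move=> /(_ (esym e)) ->].
move=> /eqP; rewrite eq_sym -subr_eq0 -natrB // pchar0_natr_eq0 subn_eq0 => mn.
by apply/eqP; rewrite eqn_leq nm mn.
Qed.

Lemma pchar0_intr_eq0 (k : int) : k%:~R = 0 :> L -> k = 0.
Proof.
case: k => n; first by move=> /eqP; rewrite pchar0_natr_eq0 => /eqP ->.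
by rewrite NegzE mulrNz => /eqP; rewrite oppr_eq0 pchar0_natr_eq0.
Qed.

(** In characteristic zero the translates are distinct, so each entry of [rs] is met at most
    once. *)
Lemma left_translates_bounded z (rs : seq L) :
  exists N, forall n : nat, z - n%:R \in rs -> (n <= N)%N.
Proof.
elim: rs => [|x rs [N hN]]; first by exists 0%N.
have [[n0 en0]|no] := pselect (exists n : nat, z - n%:R = x).
  exists (maxn N n0) => n; rewrite inE => /orP[/eqP|/hN h]; last by rewrite leq_max h.
  by rewrite -en0 => /addrI/oppr_inj/pchar0_natr_inj ->; rewrite leq_maxr.
exists N => n; rewrite inE => /orP[/eqP e|/hN //].
by case: no; exists n.
Qed.

(** The leftmost singularity of the orbit corresponds to the largest [m], which exists because
    $\ell_0\ell_r$ has finitely many roots. *)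
Lemma exists_min_sing z : sing z -> exists m : nat,
  sing (z - m%:R) /\ forall rho, sing rho -> is_intL (rho - z) ->
    exists n : nat, rho = z - m%:R + n%:R.
Proof.
move=> sz; pose P n := root (map_poly io (ell`_0 * ell`_r)) (z - n%:R).
have p0 : map_poly io (ell`_0 * ell`_r) != 0 by rewrite map_poly_eq0 mulf_neq0.
have [rs ers] := closed_field_poly_normal (map_poly io (ell`_0 * ell`_r)).
have [N hN] := left_translates_bounded z rs.
have Pbd n : P n -> (n <= N)%N.
  rewrite /P ers rootZ ?lead_coef_eq0 // root_prod_XsubC; exact: hN.
have exP : exists n, P n by exists 0%N; rewrite /P subr0.
have [m Pm mmax] := ex_maxnP exP Pbd; exists m; split=> // rho srho [k ek].
have erho : rho = z + k%:~R by rewrite -ek addrC subrK.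
case: (leP (- m%:Z) k) => h.
  exists `|(k + m%:Z)%R|%N; rewrite erho -addrA; congr (_ + _).
  rewrite -[`|_|%N%:R]/(`|_|%N%:~R) gez0_abs; last by lia.
  by rewrite rmorphD /= addrC -addrA subrr addr0.
have ek' : k = - (`|k|%N)%:Z by lia.
suff /mmax : P `|k|%N by lia.
by rewrite /P; move: srho; rewrite /sing_root erho {1}ek' mulrNz.
Qed.

(** The remaining combination, [z] in $Z$ but not [z + 1], occurs only at the right ends of the
    intervals, which are the betas. *)
Variant orbit_position z : Prop :=
| OrbitInside of inZ io r ell beta z & inZ io r ell beta (z + 1)
| OrbitLeftEnd of ~ inZ io r ell beta z & inZ io r ell beta (z + 1)
    & (forall n : nat, ~ sing (z - n.+1%:R))
| OrbitOutside of ~ inZ io r ell beta z & ~ inZ io r ell beta (z + 1) & ~ sing z.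

Lemma orbit_positionP z : (forall i, z <> beta i) -> orbit_position z.
Proof.
case: Hbeta => _ [_ [Hex [Hmax _]]] zb.
have [iz|niz] := pselect (inZ io r ell beta z).
  apply: OrbitInside => //; case: iz => i [[[|n] en] [rho [srho [irho [rmin [m em]]]]]].
    by case: (zb i); rewrite en addr0.
  exists i; split; first by exists n; rewrite en -addrA -natr1 [_ + 1]addrC.
  exists rho; do 3 split => //; exists m.+1.
  by rewrite em -addrA natr1.
have [iz1|niz1] := pselect (inZ io r ell beta (z + 1)).
  apply: OrbitLeftEnd => //.
  case: iz1 => i [[n en] [rho [srho [irho [rmin [m em]]]]]].
  have {}em : z = rho + m%:R by apply: (addIr 1); rewrite em -addrA natr1.
  (* For positive [m] the point [z] would itself lie in $Z$; so [z] is the leftmost root [rho]. *)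
  case: m em => [|m] em; last first.
    case: niz; exists i; split; last by exists rho; do 3 split => //; exists m.
    by exists n.+1; rewrite en -addrA -natr1 [_ + 1]addrC.
  move: em; rewrite addr0 => -> k sk.
  have [|k' ek] := rmin _ sk.
    case: irho => t et; exists (t - k.+1%:Z).
    by rewrite rmorphB /= -et addrAC.
  move: ek => /addrI/eqP; rewrite -subr_eq0 -opprD oppr_eq0.
  by rewrite -natrD pchar0_natr_eq0 addSn.
(* A singular [z] other than a beta lies strictly left of the beta of its orbit and not left of the
   smallest root, which would put [z + 1] in $Z$. *)
apply: OrbitOutside => // sz; have [i [k ek]] := Hex z sz.
have [n en] := Hmax i z sz (ex_intro _ k ek).
case: n en => [|n] en; first by case: (zb i); rewrite en addr0.
have [m [sm mmin]] := exists_min_sing sz.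
case: niz1; exists i; split.
  by exists n; rewrite en -addrA -natr1 [_ + 1]addrC.
exists (z - m%:R); split=> //; split; last split.
- exists (k - m%:Z); by rewrite rmorphB /= -ek addrAC.
- move=> rho srho [t et]; apply: mmin => //; exists (t - k).
  by rewrite rmorphB /= -et -ek opprB addrA subrK.
- by exists m; rewrite -natr1 addrA subrK.
Qed.

Lemma shift_lattice (W : 'M[ratf C]_r) z a : suitable io ell beta W ->
  (forall i, z <> beta i) ->
  in_lattice io (z + 1) W a <-> in_lattice io z W (shiftA ell a).
Proof.
move=> [_ [Wint Wstd]] /orbit_positionP [iz iz1|niz iz1 reg|niz niz1 nsz].
- have [_ hz] := Wint _ iz; have [_ hz1] := Wint _ iz1.
  by rewrite /in_lattice -hz -hz1; exact: integral_at_shift.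
- have [_ hz1] := Wint _ iz1; have hz := Wstd _ niz.
  rewrite /in_lattice hz -hz1 integral_at_shift //; apply: integral_at_left => // n.
  by apply/negP => /eqP/rootP; exact: reg.
- rewrite /in_lattice (Wstd _ niz) (Wstd _ niz1); apply: shiftA_std => //.
  by apply/negP => /eqP/rootP; exact: nsz.
Qed.

(** Over the closed field [L] a failure of coprimality is a common root, giving two betas that
    differ by [k]; these must coincide, and characteristic zero gives [k = 0]. *)
Lemma roots_in_betas_shift_free (e : {poly C}) :
  (forall z, root (map_poly io e) z -> exists i, z = beta i) -> shift_free e.
Proof.
case: Hbeta => Hint _ eb k k0; rewrite -(coprimep_map io).
apply/Pdiv.ClosedField.coprimepP => x /eb[i ex].
rewrite map_comp_poly horner_comp map_polyXaddC rmorph_int !hornerE.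
apply/negP => /eqP/rootP/eb[j ej].
have e' : beta j - beta i = k%:~R by rewrite -ej ex addrC addKr.
have [ij|ij] := eqVneq j i; last by case: (Hint _ _ ij); exists k.
by move/eqP: k0; apply; apply: pchar0_intr_eq0; rewrite -e' ij subrr.
Qed.

End Singularities.
Theorem mainTheorem6
  (C : fieldType) (charC0 : [pchar C] =i pred0)
  (L : closedFieldType) (io : {rmorphism C -> L})
  (algL : forall z : L, exists p : {poly C}, p != 0 /\ root (map_poly io p) z)
  (r : nat) (ell : {poly {poly C}})
  (size_ell : size ell = r.+1) (ell0 : ell`_0 != 0)
  (I : nat) (beta : 'I_I -> L) (Hbeta : admissible_betas io r ell beta)
  (W : 'M[ratf C]_r) (HW : suitable io ell beta W) :
  (forall (e : {poly C}) (M : 'M[{poly C}]_r),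
     e != 0 ->
     shiftW ell W = (e%:F)^-1 *: (map_mx (fun p => p%:F) M *m W) ->
     gcd_one e M ->
     [/\ shift_free e,
         (forall z : L, root (map_poly io e) z -> exists i, z = beta i)
       & map_mx (fun p => p%:F) M \in unitmx])
  /\
  (forall (f : {poly C}) (N : 'M[{poly C}]_r),
     f != 0 ->
     W = (f%:F)^-1 *: (map_mx (fun p => p%:F) N *m shiftW ell W) ->
     gcd_one f N ->
     [/\ shift_free f,
         (forall z : L, root (map_poly io f) z -> exists i, z = beta i)
       & map_mx (fun p => p%:F) N \in unitmx]).
Proof.
have ellr : ell`_r != 0.
  have := lead_coef_eq0 ell; rewrite /lead_coef size_ell /= => ->.
  by rewrite -size_poly_eq0 size_ell.
have uW : W \in unitmx by case: HW.
have lat z a : (forall i, z <> beta i) ->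
    in_lattice io (z + 1) W a <-> in_lattice io z W (shiftA ell a).
  exact: shift_lattice.
split=> e M e0 eM gM.
  have eb z : root (map_poly io e) z -> exists i, z = beta i.
    move=> ez; apply: contrapT => nz; apply: (gcd_one_root gM ez).
    apply: (shift_lattice_loc e0 uW _ eM ez) => a /lat; apply=> i zi.
    by apply: nz; exists i.
  split; [exact: (roots_in_betas_shift_free charC0 Hbeta) | exact: eb |].
  (* $SW$ is again a basis, so its transition matrix from [W] is invertible. *)
  have := shiftW_unit ell0 ellr uW; rewrite eM scalemxAl unitmx_mul => /andP[+ _].
  rewrite unitmxZ; first exact.
  by rewrite unitfE invr_eq0 tofrac_eq0.
have eb z : root (map_poly io e) z -> exists i, z = beta i.
  move=> ez; apply: contrapT => nz; apply: (gcd_one_root gM ez).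
  apply: (unshift_lattice_loc ell0 ellr e0 uW _ eM ez) => a; apply: (iffRL (lat _ _ _)) => i zi.
  by apply: nz; exists i.
split; [exact: (roots_in_betas_shift_free charC0 Hbeta) | exact: eb |].
move: uW; rewrite {1}eM scalemxAl unitmx_mul => /andP[+ _].
rewrite unitmxZ; first exact.
by rewrite unitfE invr_eq0 tofrac_eq0.
Qed.
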